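(* Let $p$ be a complex polynomial of degree $d\ge 1$ with $d$ simple roots $\lambda_1,\dots,\lambda_d\in\mathbb C$, let $n\ge 0$ be an integer, and let $\varphi$ be holomorphic at the points $\lambda_k$ (i.e. in a neighbourhood of $\{\lambda_1,\dots,\lambda_d\}$). Let $f_1,\dots,f_d$ be the components of the multicentric representation of $\varphi$. Then the truncated polynomial $$P(z)=\sum_{k=1}^d \delta_k(z)\,\lfloor f_k\rfloor_n(p(z))$$ is the unique polynomial of degree at most $d(n+1)-1$ satisfying the Hermite interpolation conditions $$P^{(\nu)}(\lambda_k)=\varphi^{(\nu)}(\lambda_k)\quad\text{for } \nu=0,\dots,n,\ \ k=1,\dots,d.$$
   Context: For $k=1,\dots,d$ let $\delta_k$ be the Lagrange basis polynomial of degree $d-1$ with $\delta_k(\lambda_k)=1$ and $\delta_k(\lambda_j)=0$ for $j\neq k$. For $\varphi$ holomorphic in a neighbourhood of $\{\lambda_1,\dots,\lambda_d\}$ (the neighbourhood need not be connected), the multicentric representation of $\varphi$ is $$\varphi(z)=\sum_{k=1}^d \delta_k(z)\, f_k(p(z)),$$ valid for all $z$ with $|p(z)|$ sufficiently small, where $f_1,\dots,f_d$ are the (uniquely determined) functions holomorphic in a neighbourhood of $0$ for which this holds. Writing $f_k(w)=\sum_{j\ge 0}\alpha_{k,j}w^j$, the truncation is $\lfloor f_k\rfloor_n(w)=\sum_{j=0}^n\alpha_{k,j}w^j$, so $\lfloor f_k\rfloor_n(p(z))=\sum_{j=0}^n\alpha_{k,j}\,p(z)^j$. *)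

(* Defs.v *)
From HB Require Import structures.
From mathcomp Require Export all_boot all_order all_algebra.
From mathcomp Require Export all_classical all_reals all_analysis.
From mathcomp Require Export complex.

Set Implicit Arguments.
Unset Strict Implicit.
Unset Printing Implicit Defensive.

Import Order.TTheory GRing.Theory Num.Theory.
Import numFieldNormedType.Exports.

Local Open Scope classical_set_scope.
Local Open Scope ring_scope.

(* The complex numbers over R, packaged as a numClosedFieldType so that the
   topology and normed module structure that numFieldNormedType attaches to
   every numFieldType apply; they are not declared on R[i] itself. *)
Definition Cplx (R : realType) : numClosedFieldType := R[i].

Section Multicentric.
Variable R : realType.
Local Notation C := (Cplx R).

(* Complex differentiability in a neighbourhood of a: the scalars of [derivable]
   are those of the numFieldType C. Only the values of f near a matter. *)
Definition holomorphic_at (f : C -> C) (a : C) : Prop :=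
  \forall z \near a, derivable f z 1.

Definition lagrange_basis (d : nat) (lam : 'I_d -> C) (k : 'I_d) : {poly C} :=
  \prod_(j < d | j != k) ((lam k - lam j)^-1 *: ('X - (lam j)%:P)).

Lemma lagrange_basis_sample (d : nat) (lam : 'I_d -> C) (k j : 'I_d) :
  injective lam -> (lagrange_basis lam k).[lam j] = (j == k)%:R.
Proof.
move=> lam_inj; rewrite /lagrange_basis horner_prod.
have [->|neq_jk] := eqVneq j k.
  apply: big1 => i neq_ik; rewrite !hornerE mulVf // subr_eq0.
  by apply: contra neq_ik => /eqP/lam_inj ->.
by rewrite (bigD1 j) //= !hornerE subrr mulr0 mul0r.
Qed.

Lemma size_lagrange_basis (d : nat) (lam : 'I_d -> C) (k : 'I_d) :
  injective lam -> size (lagrange_basis lam k) = d.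
Proof.
move=> lam_inj; rewrite /lagrange_basis scaler_prod size_scale; last first.
  apply/prodf_neq0 => i neq_ik; rewrite invr_eq0 subr_eq0.
  by apply: contra neq_ik => /eqP/lam_inj ->.
rewrite -big_filter size_prod_XsubC size_filter -sum1_count sum1_card.
by rewrite cardC1 card_ord; case: d k lam lam_inj => [[]|].
Qed.

(* The order of C being partial, 0 < r says that r is real and positive. *)
Definition multicentric_components (d : nat) (p : {poly C}) (lam : 'I_d -> C)
    (phi : C -> C) (f : 'I_d -> C -> C) : Prop :=
  (forall k, holomorphic_at (f k) 0) /\
  (exists2 r : C, 0 < r &
     forall z : C, `|p.[z]| < r ->
       phi z = \sum_(k < d) (lagrange_basis lam k).[z] * f k p.[z]).

Definition power_series_at0 (f : C -> C) (a : nat -> C) : Prop :=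
  \forall w \near (0 : C), series (fun j => a j * w ^+ j) @ \oo --> f w.

Definition truncation (n : nat) (a : nat -> C) : {poly C} :=
  \poly_(j < n.+1) a j.

Definition multicentric_poly (d : nat) (p : {poly C}) (lam : 'I_d -> C)
    (alpha : 'I_d -> nat -> C) (n : nat) : {poly C} :=
  \sum_(k < d) lagrange_basis lam k * (truncation n (alpha k) \Po p).

Definition hermite_interpolates (d : nat) (lam : 'I_d -> C) (phi : C -> C)
    (n : nat) (P : {poly C}) : Prop :=
  forall (k : 'I_d) (nu : nat), (nu <= n)%N ->
    P^`(nu).[lam k] = derive1n nu phi (lam k).

End Multicentric.

(* Main.v *)
Require Import Defs.
From mathcomp Require Import ring zify.

(** Write [f_k(w) = T_k(w) + O(w^(n+1))], with [T_k] the truncation of [f_k].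
    Every [lam k] is a zero of [p], so replacing [f_k (p z)] by [T_k (p z)]
    changes [phi] near [lam k] only by a multiple of [p(z)^(n+1)], which does
    not affect the derivatives of order at most [n] at [lam k].

    This is made precise without factoring the remainder. The functions that
    are near [x] of the form [sum_i q_i(z) f_i(p(z))], with [q_i] polynomials
    and [f_i] power series at 0, are closed under differentiation: both [f_i]
    and its derivative occur in the result. Iterating this rule [nu] times and
    evaluating at a zero [x] of [p] involves only the coefficients of order at
    most [nu] of the [f_i], so polynomials with the same coefficients give the
    same value. This is [derive1n_comp_sum].

    The analytic ingredient is that a convergent complex power series may be
    differentiated term by term ([power_series_derive]). The terms of a series
    converging at [c > 0] satisfy [|a_j| c^j <= M], hence on the disk of
    radius [c / 4] the derived series is dominated by a geometric one, and the
    difference quotients of the partial sums differ from their derivatives by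
    at most [K |h|], uniformly in the number of terms; this survives in the
    limit.

    Uniqueness is algebraic: the difference of two solutions is divisible by
    each [('X - lam k)^(n+1)], hence by their product, whose degree
    [d * (n+1)] is too large. *)

Set Implicit Arguments.
Unset Strict Implicit.
Unset Printing Implicit Defensive.

Import Order.TTheory GRing.Theory Num.Theory.
Import numFieldNormedType.Exports.

Local Open Scope classical_set_scope.
Local Open Scope ring_scope.

(** * Differentiation over a field with a norm *)

Lemma is_derive_quadratic (F : numFieldType) (f : F -> F) (w g K : F) :
  (\forall h \near (0 : F), `|f (h + w) - f w - h * g| <= K * `|h| ^+ 2) ->
  is_derive w (1 : F) f g.
Proof.
move=> fK.
have cvgf : h^-1 *: (f (h *: (1 : F) + w) - f w) @[h --> 0^'] --> g.
  apply/cvgrPdist_le => e e0.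
  near=> h.
  have h0 : h != 0 by near: h; exact: nbhs_dnbhs_neq.
  have hK : `|f (h + w) - f w - h * g| <= K * `|h| ^+ 2.
    by near: h; exact: cvg_within.
  (* The 1 is added because K may vanish. *)
  have he : `|K| * `|h| <= e.
    have : `|h| <= e / (`|K| + 1).
      near: h; apply: cvg_within; apply/nbhs_ballP.
      exists (e / (`|K| + 1)); first by rewrite /= divr_gt0 // ltr_wpDl.
      by move=> x; rewrite /ball /= sub0r normrN => /ltW.
    rewrite ler_pdivlMr ?ltr_wpDl // mulrC; apply: le_trans.
    by rewrite ler_wpM2r // lerDl.
  rewrite [h *: 1]mulr1 distrC.
  have -> : h^-1 *: (f (h + w) - f w) - g = h^-1 * (f (h + w) - f w - h * g).
    by rewrite [_ *: _]/(_ * _) mulrBr mulKf.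
  rewrite normrM normfV ler_pdivrMl ?normr_gt0 //.
  have K0 : 0 <= K.
    have := le_trans (normr_ge0 _) hK.
    by rewrite pmulr_lge0 // exprn_gt0 // normr_gt0.
  rewrite (le_trans hK) // expr2 mulrA [leRHS]mulrC ler_wpM2r //.
  by rewrite -{1}(ger0_norm K0).
have dfl := cvg_lim (@norm_hausdorff _ _) cvgf.
apply: DeriveDef; last exact: dfl.
by apply/cvg_ex; exists g.
Unshelve. all: by end_near. Qed.

Lemma is_derive_horner (F : numFieldType) (p : {poly F}) (w : F) :
  is_derive w (1 : F) (horner p) p^`().[w].
Proof.
elim/poly_ind: p => [|p c IH].
  rewrite deriv0 horner0.
  have -> : horner (0 : {poly F}) = cst 0 by apply/funext => z; rewrite horner0.
  exact: is_derive_cst.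
have -> : horner (p * 'X + c%:P) = horner p * id + cst c.
  by apply/funext => z; rewrite !hornerE.
apply: is_derive_eq.
rewrite derivD derivM derivX derivC !hornerE /=.
by rewrite ![_ *: _]mulrC mul1r addrC.
Qed.

Lemma is_derive_comp (F : numFieldType) (f g : F -> F) (w a b : F) :
  is_derive (g w) (1 : F) f a -> is_derive w (1 : F) g b ->
  is_derive w (1 : F) (f \o g) (a * b).
Proof.
move=> [/derivable1_diffP df fa] [/derivable1_diffP dg gb].
apply: DeriveDef; first exact/derivable1_diffP/differentiable_comp.
rewrite deriveE; last exact: differentiable_comp.
rewrite diff_comp //= -[X in 'd f _ X]mulr1 linearZ /=.
by rewrite -(deriveE _ dg) -(deriveE _ df) fa gb mulrC.
Qed.

Lemma near_horner_root (F : numFieldType) (p : {poly F}) (x : F)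
    (P : F -> Prop) :
  p.[x] = 0 -> (\forall w \near (0 : F), P w) -> \forall z \near x, P p.[z].
Proof.
move=> px0 P0.
have dp := is_derive_horner p x.
have cp : {for x, continuous (horner p)}.
  by apply/differentiable_continuous/derivable1_diffP; exact: ex_derive.
have {}cp : horner p z @[z --> x] --> (0 : F) by rewrite -px0; exact: cp.
exact: cp.
Qed.

(** * Uniform second-order estimate for partial sums of power series *)

Lemma cvg_norm_le (F : numFieldType) (u : nat -> F) (l K : F) :
  (forall n, `|u n| <= K) -> u @ \oo --> l -> `|l| <= K.
Proof.
move=> uK /cvgrPdist_le ul; apply/ler_addgt0Pr => e e0.
have [n _ /(_ n (leqnn n)) /= une] := ul e e0.
by rewrite -(subrK (u n) l) addrC (le_trans (ler_normD _ _)) // lerD.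
Qed.

(** The remainders [D_j] of the monomials satisfy
    [D_(j+1) = (h + w) D_j + j h^2 w^(j-1)], whence the bound by induction.
    The factor [s ^+ 2] avoids negative powers of [s] for [j < 2]. *)
Lemma expr_remainder_le (F : numFieldType) (w h s : F) (j : nat) :
  `|w| <= s -> `|h + w| <= s ->
  s ^+ 2 * `|(h + w) ^+ j - w ^+ j - h * (j%:R * w ^+ j.-1)|
    <= `|h| ^+ 2 * (j ^ 2)%:R * s ^+ j.
Proof.
move=> ws hws; have s0 : 0 <= s by apply: le_trans ws.
elim: j => [|j IHj].
  by rewrite !expr0 mul0r mulr0 subr0 subrr normr0 !mulr0 mul0r.
have -> : (h + w) ^+ j.+1 - w ^+ j.+1 - h * (j.+1%:R * w ^+ j.+1.-1) =
    (h + w) * ((h + w) ^+ j - w ^+ j - h * (j%:R * w ^+ j.-1))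
    + h ^+ 2 * (j%:R * w ^+ j.-1).
  case: j {IHj} => [|j]; first by rewrite !expr0 /= !expr1; ring.
  by rewrite /= !exprS; ring.
rewrite (le_trans (ler_wpM2l _ (ler_normD _ _))) ?exprn_ge0 // mulrDr.
rewrite (@le_trans _ _ (s * (`|h| ^+ 2 * (j ^ 2)%:R * s ^+ j) +
   `|h| ^+ 2 * (j%:R * s ^+ j.+1))) //.
  apply: lerD.
    rewrite normrM mulrCA; apply: ler_pM => //.
    by rewrite mulr_ge0 // exprn_ge0.
  rewrite normrM normrX mulrCA ler_wpM2l ?exprn_ge0 // normrM normr_nat mulrCA.
  case: j {IHj} => [|j]; first by rewrite !mul0r.
  rewrite ler_wpM2l // normrX /= [s ^+ j.+2](exprD s 2 j).
  rewrite ler_wpM2l ?exprn_ge0 //.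
  by rewrite lerXn2r // nnegrE.
have -> : s * (`|h| ^+ 2 * (j ^ 2)%:R * s ^+ j) + `|h| ^+ 2 * (j%:R * s ^+ j.+1)
    = `|h| ^+ 2 * ((j ^ 2 + j)%:R * s ^+ j.+1).
  by rewrite natrD (exprS s); ring.
rewrite -mulrA ler_wpM2l ?exprn_ge0 // ler_wpM2r ?exprn_ge0 // ler_nat.
by rewrite -(addn1 j) sqrnD muln1; lia.
Qed.

Lemma sqr_le_exp2 (j : nat) : (j ^ 2 <= 2 ^ j.+1)%N.
Proof.
elim: j => // j IHj; have := ltn_expl j (isT : (1 < 2)%N).
move: IHj; rewrite -!mulnn !(expnS 2); move: (2 ^ j)%N => x; nia.
Qed.

Lemma sum_half_le (F : numFieldType) (N : nat) :
  \sum_(0 <= j < N) (2^-1 : F) ^+ j <= 2.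
Proof.
suff -> : \sum_(0 <= j < N) (2^-1 : F) ^+ j = 2 - 2 * 2^-1 ^+ N.
  by rewrite gerBl mulr_ge0 // exprn_ge0.
elim: N => [|N IHN]; first by rewrite big_geq // expr0; ring.
by rewrite big_nat_recr //= IHN exprS; field.
Qed.

(** The radius [c / 4] makes the weights [j^2 / 4^j], which come from
    [expr_remainder_le], at most [2 / 2^j], so that the bound does not depend
    on the number of terms. The derived series has one term less because the
    constant term of the original one has derivative 0. *)
Lemma series_remainder_le (F : numFieldType) (a : nat -> F) (M c w h : F)
    (N : nat) :
  0 < c -> (forall j, `|a j| * c ^+ j <= M) ->
  `|w| <= c / 4 -> `|h + w| <= c / 4 ->
  `|series (fun j => a j * (h + w) ^+ j) N.+1 -
    series (fun j => a j * w ^+ j) N.+1 -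
    h * series (fun j => j.+1%:R * a j.+1 * w ^+ j) N|
  <= 4 * M / (c / 4) ^+ 2 * `|h| ^+ 2.
Proof.
move=> c0 aM ws hws; set s := c / 4; have s0 : 0 < s by rewrite divr_gt0.
have M0 : 0 <= M.
  by apply: le_trans (aM 0%N); rewrite mulr_ge0 ?exprn_ge0 // ltW.
rewrite mulrAC ler_pdivlMr ?exprn_gt0 //.
have -> : series (fun j => a j * (h + w) ^+ j) N.+1 -
    series (fun j => a j * w ^+ j) N.+1 -
    h * series (fun j => j.+1%:R * a j.+1 * w ^+ j) N =
  \sum_(0 <= j < N.+1)
    a j * ((h + w) ^+ j - w ^+ j - h * (j%:R * w ^+ j.-1)).
  rewrite [RHS](eq_bigr (fun j => a j * (h + w) ^+ j - a j * w ^+ j -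
     h * (j%:R * a j * w ^+ j.-1))); last by move=> j _; ring.
  rewrite !sumrB /series /=; congr (_ - _).
  by rewrite -mulr_sumr [in RHS]big_nat_recl //= !mul0r add0r.
rewrite (le_trans (ler_wpM2r (exprn_ge0 _ (ltW s0)) (ler_norm_sum _ _ _))) //.
apply: (@le_trans _ _ (\sum_(0 <= j < N.+1) 2 * M * `|h| ^+ 2 * 2^-1 ^+ j)).
  rewrite mulr_suml; apply: ler_sum => j _; rewrite normrM mulrAC -mulrA.
  rewrite (le_trans (ler_wpM2l _ (expr_remainder_le j ws hws))) //.
  have -> : s ^+ j = c ^+ j * (4^-1) ^+ j by rewrite -exprMn.
  rewrite (_ : `|a j| * _ =
    `|h| ^+ 2 * ((`|a j| * c ^+ j) * ((j ^ 2)%:R * 4^-1 ^+ j))); last by ring.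
  rewrite (_ : 2 * M * _ * _ = `|h| ^+ 2 * (M * (2 * 2^-1 ^+ j))); last by ring.
  rewrite ler_wpM2l ?exprn_ge0 // ler_pM //.
    by rewrite mulr_ge0 // exprn_ge0 // ltW.
  rewrite (_ : 4 = 2 * 2 :> F) ; last by ring.
  rewrite invfM exprMn mulrA ler_wpM2r ?exprn_ge0 //.
  rewrite exprVn ler_pdivrMr ?exprn_gt0 //.
  by rewrite -exprS -natrX ler_nat sqr_le_exp2.
rewrite -mulr_sumr (le_trans (ler_wpM2l _ (sum_half_le _ _))) //.
  by rewrite !mulr_ge0 // exprn_ge0.
by rewrite le_eqVlt; apply/orP; left; apply/eqP; ring.
Qed.

(** * Termwise differentiation of complex power series *)

(** The completeness of the complex numbers is drawn here from that of [R],
    applied to the series of real and of imaginary parts. *)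
Lemma is_cvg_series_dominated (R : realType) (u : nat -> Cplx R)
    (v : nat -> R) :
  (forall j, `|u j| <= (v j)%:C%C :> Cplx R) ->
  cvgn (series v) -> cvgn (series u).
Proof.
move=> uv cv.
have v0 j : 0 <= v j.
  by rewrite -lecR; apply: le_trans (uv j); rewrite normr_ge0.
have part_cvg (T : Cplx R -> R) :
    (forall z : Cplx R, `|T z|%:C%C <= `|z| :> Cplx R) ->
    cvgn (series (T \o u)).
  move=> Tle; apply: normed_cvg; apply: (series_le_cvg _ v0 _ cv) => j //=.
  by rewrite -lecR; apply: le_trans (uv j); exact: Tle.
have Re_le (z : Cplx R) : `|complex.Re z|%:C%C <= `|z| :> Cplx R.
  exact: normc_ge_Re.
have Im_le (z : Cplx R) : `|complex.Im z|%:C%C <= `|z| :> Cplx R.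
  by rewrite normc_def lecR -sqrtr_sqr ler_wsqrtr // lerDr sqr_ge0.
have /cvg_ex[x cx] := part_cvg _ Re_le; have /cvg_ex[y cy] := part_cvg _ Im_le.
apply/cvg_ex; exists (x +i* y)%C; apply/cvgrPdist_lt => e e0.
have eE : (complex.Re e)%:C%C = e :> Cplx R by rewrite RRe_real // gtr0_real.
have Re0 : 0 < complex.Re e / 2.
  by rewrite divr_gt0 // -ltcR eE.
move/cvgrPdist_lt/(_ _ Re0): cx => cx.
move/cvgrPdist_lt/(_ _ Re0): cy => cy.
have seriesE n : series u n =
    (series (@complex.Re R \o u) n +i* series (@complex.Im R \o u) n)%C.
  rewrite /series /=; elim: n => [|n IHn]; first by rewrite !big_geq.
  by rewrite !big_nat_recr //= IHn; case: (u n).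
near=> n; rewrite seriesE.
rewrite normc_def -eE ltcR /=.
have cxn : `|x - series (@complex.Re R \o u) n| < complex.Re e / 2 by near: n.
have cyn : `|y - series (@complex.Im R \o u) n| < complex.Re e / 2 by near: n.
rewrite [ltRHS]splitr; apply: le_lt_trans (ltrD cxn cyn).
rewrite -[leRHS]ger0_norm ?addr_ge0 // -[leRHS]sqrtr_sqr ler_wsqrtr //.
rewrite [leRHS]sqrrD !real_normK ?num_real // addrAC lerDl.
by rewrite mulrn_wge0 // mulr_ge0.
Unshelve. all: by end_near. Qed.

Lemma power_series_value (R : realType) (f : Cplx R -> Cplx R)
    (a : nat -> Cplx R) :
  power_series_at0 f a -> f 0 = a 0%N.
Proof.
move=> /nbhs_singleton; rewrite -cvg_shiftS => cf.
rewrite -(cvg_lim (@norm_hausdorff _ _) cf).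
apply: lim_near_cst; first exact: norm_hausdorff.
near=> n.
rewrite /series /= big_nat_recl //= mulr1 big1 ?addr0 // => i _.
by rewrite expr0n mulr0.
Unshelve. all: by end_near. Qed.

(** The conclusion is again a statement on a power series at 0, so the lemma
    can be applied repeatedly. *)
Lemma power_series_derive (R : realType) (f : Cplx R -> Cplx R)
    (a : nat -> Cplx R) :
  power_series_at0 f a ->
  (\forall w \near (0 : Cplx R),
     is_derive w (1 : Cplx R) f (f^`()%classic w)) /\
  power_series_at0 f^`()%classic (fun j => j.+1%:R * a j.+1).
Proof.
move=> /nbhs_ballP[r /= r0 rf].
pose c : Cplx R := r / 2; have c0 : 0 < c by rewrite divr_gt0.
have fE w : `|w| <= c -> series (fun j => a j * w ^+ j) @ \oo --> f w.
  move=> wc; apply: rf; rewrite /ball /= sub0r normrN.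
  by apply: le_lt_trans wc _; rewrite /c ltr_pdivrMr // ltr_pMr // ltr1n.
have [M aM] : exists M, forall j, `|a j| * c ^+ j <= M.
  have /cvg_series_cvg_0 : cvgn (series (fun j => a j * c ^+ j)).
    by apply/cvg_ex; exists (f c); apply: fE; rewrite gtr0_norm.
  move=> /(cvgP _)/cvg_seq_bounded[M [Mreal /(_ (M + 1))]].
  rewrite ltrDl => /(_ ltr01) aM; exists (M + 1) => j.
  by have /= := aM j I; rewrite normrM normrX (gtr0_norm c0).
have M0 : 0 <= M.
  by apply: le_trans (aM 0%N); rewrite mulr_ge0 ?exprn_ge0 // ltW.
have MR : (complex.Re (M / c))%:C%C = M / c :> Cplx R.
  by rewrite RRe_real // ger0_real // divr_ge0 // ltW.
pose b j := j.+1%:R * a j.+1.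
(* On the disk of radius c / 4 the terms are at most M / c * (j + 1) / 4 ^ j,
   and j + 1 <= 2 ^ j. *)
have cvgb w : `|w| <= c / 4 -> cvgn (series (fun j => b j * w ^+ j)).
  move=> wc; pose v := geometric (complex.Re (M / c)) 2^-1.
  apply: (@is_cvg_series_dominated _ _ v); last first.
    by apply: is_cvg_geometric_series; rewrite ger0_norm // invf_lt1 // ltr1n.
  move=> j; have -> : (v j)%:C%C = M / c * 2^-1 ^+ j :> Cplx R.
    by rewrite /v /geometric /= rmorphM rmorphXn fmorphV rmorph_nat /= MR.
  rewrite normrM normrX /b normrM normr_nat.
  apply: le_trans (_ : j.+1%:R * `|a j.+1| * (c / 4) ^+ j <= _).
    by rewrite ler_wpM2l ?mulr_ge0 // lerXn2r ?nnegrE // ltW // divr_gt0.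
  have -> : j.+1%:R * `|a j.+1| * (c / 4) ^+ j =
      (`|a j.+1| * c ^+ j.+1) / c * (j.+1%:R * 4^-1 ^+ j).
    by rewrite exprMn exprS; field; rewrite gt_eqF.
  rewrite ler_pM //.
  - by rewrite divr_ge0 ?(ltW c0) // mulr_ge0 ?exprn_ge0 ?(ltW c0).
  - by rewrite ler_wpM2r ?invr_ge0 ?(ltW c0).
  rewrite (_ : 4 = 2 * 2 :> Cplx R); last by ring.
  rewrite invfM exprMn mulrA -[leRHS]mul1r ler_wpM2r ?exprn_ge0 //.
  by rewrite exprVn ler_pdivrMr ?exprn_gt0 // mul1r -natrX ler_nat ltn_expl.
have df w : `|w| < c / 4 ->
    is_derive w (1 : Cplx R) f (limn (series (fun j => b j * w ^+ j))).
  move=> wc; apply: (@is_derive_quadratic _ _ _ _ (4 * M / (c / 4) ^+ 2)).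
  have sw : 0 < c / 4 - `|w| by rewrite subr_gt0.
  apply/nbhs_ballP; exists (c / 4 - `|w|) => //= h.
  rewrite /ball /= sub0r normrN ltrBrDr => hw.
  have hwc : `|h + w| <= c / 4 by rewrite (le_trans (ler_normD _ _)) // ltW.
  have lec z : `|z| <= c / 4 -> `|z| <= c.
    move=> /le_trans; apply; rewrite ler_pdivrMr // ler_pMr //.
    by rewrite ler1n.
  apply: (cvg_norm_le (fun N => series_remainder_le N c0 aM (ltW wc) hwc)).
  apply: cvgB; last by apply: cvgMr; apply: cvgb; exact: ltW.
  by apply: cvgB; rewrite cvg_shiftS; apply: fE; apply: lec => //; exact: ltW.
have df1 w : `|w| < c / 4 ->
    f^`()%classic w = limn (series (fun j => b j * w ^+ j)).
  by move=> /df dfw; rewrite derive1E derive_val.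
have c40 : 0 < c / 4 by rewrite divr_gt0.
have near_s : \forall w \near (0 : Cplx R), `|w| < c / 4.
  apply/nbhs_ballP; exists (c / 4) => // w.
  by rewrite /ball /= sub0r normrN.
split.
  by apply: filterS near_s => w wc; rewrite df1 //; exact: df.
rewrite /power_series_at0.
apply: filterS near_s => w wc.
by rewrite df1 //; apply: cvgb; exact: ltW.
Qed.

(** * Derivatives of multicentric sums at a zero of p *)

(** By induction on [nu]: the derivative of [q_i * (f_i \o p)] is
    [q_i^`() * (f_i \o p) + q_i * p^`() * (f_i^`() \o p)], which is a sum of
    the same shape over twice as many indices, and the same rule holds with
    the polynomials [t_i] in place of the [f_i]. Asking only that [t_i] and
    [f_i] have the same coefficients up to [nu], rather than fixing [t_i] as a
    truncation, makes the hypothesis pass to [t_i^`()] and [f_i^`()]. *)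
Lemma derive1n_comp_sum (R : realType) (p : {poly Cplx R}) (x : Cplx R)
    (nu : nat) : p.[x] = 0 ->
  forall (m : nat) (phi : Cplx R -> Cplx R) (q t : 'I_m -> {poly Cplx R})
    (f : 'I_m -> Cplx R -> Cplx R) (a : 'I_m -> nat -> Cplx R),
  (forall i, power_series_at0 (f i) (a i)) ->
  (forall i j, (j <= nu)%N -> (t i)`_j = a i j) ->
  (\forall z \near x, phi z = \sum_(i < m) (q i).[z] * f i p.[z]) ->
  derive1n nu phi x = (\sum_(i < m) q i * (t i \Po p))^`(nu).[x].
Proof.
move=> px0; elim: nu => [|nu IHnu] m phi q t f a fa ta phiE.
  rewrite derive1n0 derivn0 (nbhs_singleton phiE) px0 horner_sum.
  apply: eq_bigr => i _; rewrite hornerM horner_comp px0 horner_coef0 ta //.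
  by rewrite (power_series_value (fa i)).
pose cat T (u v : 'I_m -> T) (i : 'I_(m + m)) : T :=
  match fintype.split i with inl j => u j | inr j => v j end.
have catl T (u v : 'I_m -> T) j : cat T u v (lshift m j) = u j.
  by rewrite /cat (unsplitK (inl j)).
have catr T (u v : 'I_m -> T) j : cat T u v (rshift m j) = v j.
  by rewrite /cat (unsplitK (inr j)).
rewrite derive1Sn derivSn.
rewrite (IHnu _ _ (cat _ (fun i => (q i)^`()) (fun i => q i * p^`()))
   (cat _ t (fun i => (t i)^`())) (cat _ f (fun i => (f i)^`()%classic))
   (cat _ a (fun i j => j.+1%:R * a i j.+1))).
- congr (_^`(nu).[x]); rewrite big_split_ord /= -big_split raddf_sum /=.
  apply: eq_bigr => i _; rewrite !catl !catr derivM deriv_comp.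
  by rewrite -mulrA [p^`() * _]mulrC.
- move=> i; rewrite /cat; case: (fintype.split i) => j; first exact: fa.
  by have [] := power_series_derive (fa j).
- move=> i k kn; rewrite /cat; case: (fintype.split i) => j.
    by rewrite ta // ltnW.
  by rewrite coef_deriv ta // mulr_natl.
have df := filter_forall _ (fun i =>
  near_horner_root px0 (power_series_derive (fa i)).1).
near=> z.
have dfz : forall i,
    is_derive (p.[z]) (1 : Cplx R) (f i) ((f i)^`()%classic p.[z]).
  by near: z; exact: df.
have phiz : \forall y \near z,
    (\sum_(i < m) (horner (q i) * (f i \o horner p))) y = phi y.
  have : \forall y \near z, phi y = \sum_(i < m) (q i).[y] * f i p.[y].
    by near: z; exact: (near_join phiE).
  by apply: filterS => y ->; rewrite fct_sumE.
rewrite derive1E.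
have dphi : is_derive z (1 : Cplx R)
    (\sum_(i < m) (horner (q i) * (f i \o horner p)))
    (\sum_(i < m) ((q i).[z] *: ((f i)^`()%classic p.[z] * p^`().[z]) +
                   f i p.[z] *: (q i)^`().[z])).
  apply: is_derive_sum => i; apply: is_deriveM; first exact: is_derive_horner.
  apply: is_derive_comp; [exact: dfz|exact: is_derive_horner].
have /(@derive_val _ _ _ _ _ _ _) -> := near_eq_is_derive phiz dphi.
rewrite big_split_ord /= -big_split /=; apply: eq_bigr => i _.
rewrite !catl !catr hornerM [RHS]addrC; congr (_ + _); last exact: mulrC.
by rewrite -mulrA [p^`().[z] * _]mulrC.
Unshelve. all: by end_near. Qed.

(** * Degree and uniqueness *)

(** Taylor's formula for [p] at [x], taken in the ring of polynomials: [p] is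
    its lift to polynomials in a second variable, evaluated at
    ['X = x%:P + ('X - x%:P)]. *)
Lemma dvdp_XsubC_exp_derivn (F : numFieldType) (p : {poly F}) (x : F)
    (n : nat) :
  (forall nu, (nu <= n)%N -> p^`(nu).[x] = 0) -> ('X - x%:P) ^+ n.+1 %| p.
Proof.
move=> px0.
have -> : p = \sum_(i < size p) p^`N(i).[x] *: ('X - x%:P) ^+ i.
  have := @nderiv_taylor _ (map_poly polyC p) x%:P ('X - x%:P) (mulrC _ _).
  rewrite addrC subrK -/(comp_poly 'X p) comp_polyXr size_map_polyC => {1}->.
  apply: eq_bigr => i _; rewrite nderivn_map.
  by rewrite horner_map /= mul_polyC.
apply: (big_ind (fun q => ('X - x%:P) ^+ n.+1 %| q)) => [|u v|].
- exact: dvdp0.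
- exact: dvdp_add.
move=> i _; have [lein|ltni] := leqP i n; last first.
  by rewrite -mul_polyC dvdp_mull ?dvdp_exp2l.
suff -> : p^`N(i).[x] = 0 by rewrite scale0r dvdp0.
have := px0 i lein; rewrite nderivn_def hornerMn => /eqP.
by rewrite mulrn_eq0 eqn0Ngt fact_gt0 /= => /eqP.
Qed.

Lemma hermite_zero (F : numFieldType) (d : nat) (lam : 'I_d -> F) (n : nat)
    (D : {poly F}) :
  injective lam -> (size D <= d * n.+1)%N ->
  (forall k nu, (nu <= n)%N -> D^`(nu).[lam k] = 0) -> D = 0.
Proof.
move=> lam_inj sD D0; apply: contraTeq sD => Dn0; rewrite -ltnNge.
have prod_dvd : (\prod_(k < d) ('X - (lam k)%:P)) ^+ n.+1 %| D.
  rewrite -prodrXl.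
  elim: (index_enum _) (index_enum_uniq 'I_d) => [_|k s IHs /andP[ks us]].
    by rewrite big_nil dvd1p.
  rewrite big_cons Gauss_dvdp ?IHs ?andbT // ?dvdp_XsubC_exp_derivn //.
    by move=> nu; exact: D0.
  rewrite coprimep_expl // big_seq.
  apply: (big_ind (fun q => coprimep ('X - (lam k)%:P) q)) => [|u v ku kv|j js].
  - exact: coprimep1.
  - by rewrite coprimepMr ku.
  - rewrite coprimep_expr // coprimep_XsubC root_XsubC (inj_eq lam_inj).
    by apply: contraNneq ks => <-.
apply: leq_trans (dvdp_leq Dn0 prod_dvd).
have := size_exp (\prod_(k < d) ('X - (lam k)%:P)) n.+1.
have sI : size (index_enum 'I_d) = d.
  by rewrite -sum1_size big_const_ord iter_addn_0 mul1n.
rewrite size_prod_XsubC sI /= => <-.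
rewrite prednK // lt0n size_poly_eq0 expf_neq0 //.
by rewrite -size_poly_eq0 size_prod_XsubC.
Qed.

Lemma size_multicentric_poly (R : realType) (d : nat) (p : {poly Cplx R})
    (lam : 'I_d -> Cplx R) (alpha : 'I_d -> nat -> Cplx R) (n : nat) :
  size p = d.+1 -> injective lam ->
  (size (multicentric_poly p lam alpha n) <= d * n.+1)%N.
Proof.
move=> sp lam_inj; apply: (leq_trans (size_sum _ _ _)); apply/bigmax_leqP => k _.
apply: leq_trans (size_polyMleq _ _) _; rewrite size_lagrange_basis //.
have := size_comp_poly_leq (truncation n (alpha k)) p.
have := size_poly n.+1 (alpha k); rewrite -/(truncation n (alpha k)) sp /=.
move: (size (truncation _ _)) => a; move: (size (_ \Po _)) => b h1 h2.
have : (b <= (n * d).+1)%N.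
  by apply: leq_trans h2 _; rewrite ltnS leq_mul2r; apply/orP; right; lia.
case: d {lam lam_inj alpha p sp k h2} (k) => [[]//|d _]; nia.
Qed.

Theorem proposition1p2 (R : realType) (d : nat) (p : {poly Cplx R})
    (lam : 'I_d -> Cplx R) (n : nat) (phi : Cplx R -> Cplx R)
    (f : 'I_d -> Cplx R -> Cplx R) (alpha : 'I_d -> nat -> Cplx R)
    (d_ge1 : (1 <= d)%N)
    (p_deg : size p = d.+1)
    (lam_inj : injective lam)
    (lam_simple : forall k, mup (lam k) p = 1%N)
    (phi_hol : forall k, holomorphic_at phi (lam k))
    (f_comp : multicentric_components p lam phi f)
    (alpha_f : forall k, power_series_at0 (f k) (alpha k)) :
  let P := multicentric_poly p lam alpha n in
  [/\ (size P <= d * n.+1)%N,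
      hermite_interpolates lam phi n P &
      forall Q : {poly Cplx R}, (size Q <= d * n.+1)%N ->
        hermite_interpolates lam phi n Q -> Q = P].
Proof.
move=> P; have sP : (size P <= d * n.+1)%N by exact: size_multicentric_poly.
have p_lam k : p.[lam k] = 0.
  apply/eqP; rewrite -[_ == 0]/(root p (lam k)).
  by apply/contraT => /mupNroot; rewrite lam_simple.
have hP : hermite_interpolates lam phi n P.
  move=> k nu nun; have [_ [r r0 phiE]] := f_comp.
  rewrite (@derive1n_comp_sum _ p (lam k) nu (p_lam k) _ phi (lagrange_basis lam)
    (fun i => truncation n (alpha i)) f alpha) //.
    by move=> i j jnu; rewrite coef_poly ltnS (leq_trans jnu nun).
  have near_r : \forall w \near (0 : Cplx R), `|w| < r.
    apply/nbhs_ballP; exists r => // w.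
    by rewrite /ball /= sub0r normrN.
  have := near_horner_root (p_lam k) near_r.
  by apply: filterS => z; exact: phiE.
split=> // Q sQ hQ; apply/eqP; rewrite -subr_eq0; apply/eqP.
apply: (hermite_zero (n := n) lam_inj).
  by rewrite (leq_trans (size_polyD _ _)) // size_polyN geq_max sQ.
by move=> k nu nun; rewrite derivnB hornerD hornerN hQ // hP // subrr.
Qed.
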